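(* Let $k,\ell\in\mathbb{Z}_{>0}$, $s\in\{0,\dotsc,\lfloor k/2\rfloor\}$, $t\in\{0,\dotsc,\lfloor \ell/2\rfloor\}$ and $n\in\mathbb{Z}_{\geq 0}$. For all $f\in M_k^{\leq s}$ and $g\in M_\ell^{\leq t}$, \[ D\,\Phi_{n;k,s;\ell,t}(f,g)=\Phi_{n;k,s;\ell+2,t+1}(f,Dg)+\Phi_{n;k+2,s+1;\ell,t}(Df,g), \] where for integers $n,k,s,\ell,t$, \[ \Phi_{n;k,s;\ell,t}(f,g)\coloneqq\sum_{r=0}^n(-1)^r\binom{k-s+n-1}{n-r}\binom{\ell-t+n-1}{r}D^{r}f\,D^{n-r}g. \]
   Context: $\mathcal{H}$ is the complex upper half-plane and $D\coloneqq\frac{1}{2\pi i}\frac{d}{dz}$. For $\gamma=\begin{pmatrix} a&b\\ c&d\end{pmatrix}\in\mathrm{SL}(2,\mathbb{Z})$ put $X(\gamma)(z)=\frac{c}{cz+d}$ and $(f|_k\gamma)(z)=(cz+d)^{-k}f(\gamma z)$. For integers $k,s\ge 0$, $M_k^{\leq s}$ denotes the space of holomorphic $f:\mathcal{H}\to\mathbb{C}$ for which there exist holomorphic $Q_0(f),\dots,Q_s(f)$ with $f|_k\gamma=\sum_{i=0}^sQ_i(f)X(\gamma)^i$ for all $\gamma\in\mathrm{SL}(2,\mathbb{Z})$, and whose Fourier expansion in $e^{2\pi i z}$ has no negative-index terms (quasimodular forms of weight $k$, depth $\le s$). *)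

(* Defs.v *)
(* MathComp-Analysis, with complex numbers R[i] over an arbitrary R : realType. *)
From HB Require Import structures.
From mathcomp Require Import all_boot all_order all_algebra.
From mathcomp Require Import complex.
From mathcomp Require Import all_classical all_reals all_analysis.

Set Implicit Arguments.
Unset Strict Implicit.
Unset Printing Implicit Defensive.

Import Order.TTheory GRing.Theory Num.Theory.
Import numFieldNormedType.Exports.

Local Open Scope classical_set_scope.
Local Open Scope ring_scope.
Local Open Scope complex_scope.

(* Naming R[i] as a numFieldType gives it the canonical topology and
   normed-module structure of a numFieldType; hence [derivable f z 1] and
   [derive1 f] below are complex differentiability and the complex derivative. *)
Definition Cplx (R : realType) : numFieldType := R[i].

Definition upper_half_plane (R : realType) : set (Cplx R) :=
  [set z | 0 < complex.Im z].
Arguments upper_half_plane : clear implicits.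

(* A function on the upper half-plane is represented by a total function on
   the complex numbers whose values elsewhere are irrelevant. As the half-plane
   is open, so are they for derivatives at its points. *)
Definition holomorphic_on_H (R : realType) (f : Cplx R -> Cplx R) : Prop :=
  forall z, upper_half_plane R z -> derivable f z 1.

Definition two_pi_i (R : realType) : Cplx R := 0 +i* (2 * pi).
Arguments two_pi_i : clear implicits.

Definition cexp (R : realType) (z : Cplx R) : Cplx R :=
  let x := complex.Re z in let y := complex.Im z in
  (expR x * cos y) +i* (expR x * sin y).

Definition D (R : realType) (f : Cplx R -> Cplx R) : Cplx R -> Cplx R :=
  fun z => (two_pi_i R)^-1 * derive1 f z.

Section Slash.
Variables (R : realType) (g : 'M[int]_2).

Let a : Cplx R := (g ord0 ord0)%:~R.
Let b : Cplx R := (g ord0 ord_max)%:~R.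
Let c : Cplx R := (g ord_max ord0)%:~R.
Let d : Cplx R := (g ord_max ord_max)%:~R.

Definition moebius (z : Cplx R) : Cplx R := (a * z + b) / (c * z + d).

Definition Xfun (z : Cplx R) : Cplx R := c / (c * z + d).

Definition slash (k : nat) (f : Cplx R -> Cplx R) : Cplx R -> Cplx R :=
  fun z => (c * z + d) ^- k * f (moebius z).

End Slash.

(* Taking the transformation law at the matrix (1 1; 0 1) and at the identity
   shows that f is 1-periodic, so it has a unique expansion in integer powers
   of exp(2 pi i z); the last clause says that only indices m >= 0 occur. *)
Definition quasimodular (R : realType) (k s : nat) (f : Cplx R -> Cplx R)
    : Prop :=
  [/\ holomorphic_on_H f,
      exists Q : 'I_s.+1 -> Cplx R -> Cplx R,
        (forall i, holomorphic_on_H (Q i)) /\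
        (forall g : 'M[int]_2, \det g = 1 ->
         forall z, upper_half_plane R z ->
           slash g k f z = \sum_(i < s.+1) Q i z * Xfun g z ^+ i)
    & exists q : nat -> Cplx R,
        forall z, upper_half_plane R z ->
          series (fun m => q m * cexp (two_pi_i R * m%:R * z)) @ \oo --> f z].

(* Generalized binomial coefficient x (x - 1) ... (x - m + 1) / m!. *)
Definition binomz (R : realType) (x : int) (m : nat) : Cplx R :=
  (\prod_(j < m) (x - j%:Z))%:~R / (m`!)%:R.
Arguments binomz : clear implicits.

Definition Phi (R : realType) (n : nat) (k s l t : int)
    (f g : Cplx R -> Cplx R) : Cplx R -> Cplx R :=
  fun z => \sum_(r < n.+1)
    (-1) ^+ r * binomz R (k - s + n%:Z - 1) (n - r)
              * binomz R (l - t + n%:Z - 1) r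
              * iter r (@D R) f z * iter (n - r) (@D R) g z.

(* Main.v *)
(* The Fourier expansion writes f as a power series P in w = exp(2 pi i z).
   Convergence at the point halfway down to the real axis below z bounds the
   coefficients geometrically at a radius > |w|, so P may be differentiated
   termwise at w, and D multiplies the m-th Fourier coefficient by m. Hence all
   D^r f and D^r g are differentiable on the half-plane, and the theorem becomes
   a comparison of Leibniz-rule coefficients, where Pascal's rule makes the
   discrepancies of the two right-hand terms cancel. *)
Require Import Defs.
From HB Require Import structures.
From mathcomp Require Import all_boot all_order all_algebra.
From mathcomp Require Import complex.
From mathcomp Require Import all_classical all_reals all_analysis.
From mathcomp Require Import ring lra.

Import Order.TTheory GRing.Theory Num.Theory.
Import numFieldNormedType.Exports.

Local Open Scope ring_scope.

(** * Generalized binomial coefficients and the Leibniz coefficient identity *)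

Lemma binomz0 (R : realType) (x : int) : binomz R x 0 = 1.
Proof. by rewrite /binomz big_ord0 fact0 divr1. Qed.

(** Pascal's rule: over the common factor p = x (x - 1) ... (x - m + 1) it reduces to x + 1 = (x -
    m) + (m + 1). *)
Lemma binomzS (R : realType) (x : int) (m : nat) :
  binomz R (x + 1) m.+1 = binomz R x m.+1 + binomz R x m.
Proof.
rewrite /binomz big_ord_recl big_ord_recr /= subr0.
have -> : \prod_(i < m) (x + 1 - (bump 0 i)%:Z) = \prod_(i < m) (x - i%:Z).
  by apply: eq_bigr => i _; rewrite /bump /= add1n -addn1 PoszD; ring.
set p := \prod_(i < m) _.
have mf0 : (m`!)%:R != 0 :> Cplx R by rewrite pnatr_eq0 -lt0n fact_gt0.
have m10 : (m.+1)%:R != 0 :> Cplx R by rewrite pnatr_eq0.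
rewrite factS natrM !rmorphM !rmorphD /= rmorphN /= -pmulrn -[m.+1]addn1 natrD.
rewrite -addn1 natrD in m10.
by field; rewrite mf0 m10.
Qed.

(* The two sides differ by two sums with the summand
   (-1)^r C(A,n-r-1) C(B,r) F_(r+1) G_(n-r), 0 <= r < n, and opposite signs. *)
Lemma leibniz_binomz (R : realType) (n : nat) (A B : int) (F G : nat -> Cplx R) :
  \sum_(r < n.+1) (-1) ^+ r * binomz R A (n - r) * binomz R B r *
      (F r.+1 * G (n - r)%N + F r * G (n - r).+1)
  = \sum_(r < n.+1) (-1) ^+ r * binomz R A (n - r) * binomz R (B + 1) r *
      F r * G (n - r).+1
    + \sum_(r < n.+1) (-1) ^+ r * binomz R (A + 1) (n - r) * binomz R B r *
      F r.+1 * G (n - r)%N.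
Proof.
pose T r := (-1) ^+ r * binomz R A (n - r.+1) * binomz R B r * F r.+1 * G (n - r)%N.
have -> : \sum_(r < n.+1) (-1) ^+ r * binomz R A (n - r) * binomz R (B + 1) r *
      F r * G (n - r).+1 = \sum_(r < n.+1) (-1) ^+ r * binomz R A (n - r) *
      binomz R B r * F r * G (n - r).+1 - \sum_(r < n) T r.
  (* The terms r = 0 agree, since C(B,0) = C(B+1,0) = 1. For r = i + 1, Pascal's rule in B leaves
     [T i], with a minus sign from (-1)^(i+1). *)
  rewrite !big_ord_recl /= !binomz0 -addrA; congr (_ + _).
  rewrite -sumrB; apply: eq_bigr => i _.
  rewrite /bump /= add1n binomzS /T exprS (_ : (n - i.+1).+1 = n - i)%N; first ring.
  by rewrite subnSK.
have -> : \sum_(r < n.+1) (-1) ^+ r * binomz R (A + 1) (n - r) * binomz R B r *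
      F r.+1 * G (n - r)%N = \sum_(r < n.+1) (-1) ^+ r * binomz R A (n - r) *
      binomz R B r * F r.+1 * G (n - r)%N + \sum_(r < n) T r.
  (* Here the terms r = n agree, having lower argument n - r = 0; Pascal's rule in A treats the
     others. *)
  rewrite !big_ord_recr /= !subnn !binomz0 addrAC; congr (_ + _).
  rewrite -big_split /=; apply: eq_bigr => i _.
  by rewrite /T -(subnSK (ltn_ord i)) binomzS; ring.
rewrite addrCA subrK addrC -big_split /=.
by apply: eq_bigr => i _; ring.
Qed.

(** * Derivatives from a quadratic remainder, and the chain rule *)

(** Dividing by h leaves an error of at most c |h|. This turns explicit estimates into derivatives,
    both for power series and for the exponential. *)
Lemma is_derive_quadratic (K : numFieldType) (f : K -> K) (z d c e : K) :
  0 < e ->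
  (forall h, `|h| < e -> `|f (h + z) - f z - h * d| <= c * `|h| ^+ 2) ->
  is_derive z (1 : K) f d.
Proof.
move=> e0 H.
(* At h = e / 2 the hypothesis bounds a norm by c times a positive number. *)
have c0 : 0 <= c.
  have e2 : 0 < e / 2 by rewrite divr_gt0.
  have := H (e / 2); rewrite gtr0_norm // ltr_pdivrMr // ltr_pMr // ltr1n => /(_ isT).
  by move/(le_trans (normr_ge0 _)); rewrite pmulr_lge0 // exprn_gt0.
suff L : (h^-1 *: (f (h *: 1 + z) - f z) @[h --> (0 : K)^'] --> d)%classic.
  apply: DeriveDef; first by apply/cvg_ex; exists d.
  exact: (cvg_lim (@norm_hausdorff _ _) L).
apply/cvgrPdist_le => eps eps0.
(* The divisor is c + 1 because c may be 0. *)
have ec : 0 < eps / (c + 1) by rewrite divr_gt0 // ltr_wpDl.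
near=> h.
have h0 : h != 0 by near: h; exact: nbhs_dnbhs_neq.
have nh0 : 0 < `|h| by rewrite normr_gt0.
have he : `|h| < e by near: h; exact: dnbhs0_lt.
have hc : `|h| < eps / (c + 1) by near: h; exact: dnbhs0_lt.
have -> : d - h^-1 *: (f (h *: 1 + z) - f z) = - (h^-1 * (f (h + z) - f z - h * d)).
  have -> : h *: 1 = h :> K by rewrite /GRing.scale /= mulr1.
  rewrite [X in d - X](_ : _ = h^-1 * (f (h + z) - f z)) //.
  by rewrite -[in LHS](mulKf h0 d) -mulrBr -mulrN !opprB addrA addrAC -addrA.
rewrite normrN normrM normfV ler_pdivrMl //.
apply: (le_trans (H h he)).
rewrite expr2 mulrCA ler_pM2l //.
rewrite ltr_pdivlMr ?ltr_wpDl // in hc.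
apply: ltW; apply: le_lt_trans hc.
by rewrite mulrC ler_pM2l // lerDl.
Unshelve. all: by end_near.
Qed.

Lemma is_derive_comp (K : numFieldType) (f g : K -> K) (z df dg : K) :
  is_derive (g z) (1 : K) f df -> is_derive z (1 : K) g dg ->
  is_derive z (1 : K) (f \o g) (df * dg).
Proof.
move=> [fd fE] [gd gE].
have fd' : differentiable f (g z) by apply/derivable1_diffP.
have gd' : differentiable g z by apply/derivable1_diffP.
have fgd : differentiable (f \o g) z by exact: differentiable_comp.
apply: DeriveDef; first by apply/derivable1_diffP.
rewrite deriveE // diff_comp //= -[X in 'd f (g z) X]deriveE // gE.
have -> : dg = dg *: (1 : K) by rewrite /GRing.scale /= mulr1.
by rewrite linearZ /= -deriveE // fE /GRing.scale /= mulr1 mulrC.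
Qed.

(** * Termwise differentiation of power series *)

Lemma cvg_norm_le (K : numFieldType) (u : nat -> K) (l c : K) :
  (u @ \oo --> l)%classic -> (forall n, `|u n| <= c) -> `|l| <= c.
Proof.
move=> ul uc; apply/ler_addgt0Pl => e e0.
have /cvgrPdist_le /(_ _ e0) [N _ /(_ N (leqnn N)) /= H] := ul.
by rewrite -(subrK (u N) l); apply: le_trans (ler_normD _ _) _; exact: lerD.
Qed.

(* Multiplied through by [w], so that the derivative [m * w ^+ m.-1] becomes
   [m * w ^+ m] and no predecessor occurs. *)
Lemma exprD_quadratic (K : numFieldType) (w h r : K) (m : nat) :
  `|w| <= r -> `|w + h| <= r ->
  r ^+ 2 * `|w * ((w + h) ^+ m - w ^+ m) - h * (m%:R * w ^+ m)| <=
    `|w| * m%:R ^+ 2 * `|h| ^+ 2 * r ^+ m.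
Proof.
move=> wr whr; have r0 : 0 <= r := le_trans (normr_ge0 _) wr.
elim: m => [|m IH].
  by rewrite !expr0 subrr mulr0 !mul0r mulr0 subrr normr0 mulr0 expr0n /= !(mulr0, mul0r).
have -> : w * ((w + h) ^+ m.+1 - w ^+ m.+1) - h * (m.+1%:R * w ^+ m.+1) =
   (w + h) * (w * ((w + h) ^+ m - w ^+ m) - h * (m%:R * w ^+ m)) +
   m%:R * h ^+ 2 * w ^+ m.
  by rewrite -natr1 !exprS; ring.
apply: (@le_trans _ _ (r * (`|w| * m%:R ^+ 2 * `|h| ^+ 2 * r ^+ m) +
  r ^+ 2 * (m%:R * `|h| ^+ 2 * `|w| ^+ m))).
  apply: (le_trans (ler_wpM2l _ (ler_normD _ _))); first by rewrite exprn_ge0.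
  rewrite mulrDr; apply: lerD; last by rewrite !normrM !normrX normr_nat.
  rewrite normrM mulrCA; apply: ler_pM => //.
  by rewrite mulr_ge0 // exprn_ge0.
rewrite exprS.
have -> : r * (`|w| * m%:R ^+ 2 * `|h| ^+ 2 * r ^+ m) =
   `|w| * m%:R ^+ 2 * `|h| ^+ 2 * (r * r ^+ m) by ring.
(* The extra term vanishes at m = 0. Otherwise |w|^m supplies the factor |w| of the bound, and m^2 +
   m <= (m + 1)^2 concludes. *)
case: m {IH} => [|m].
  rewrite expr0n /= !(mulr0, mul0r) addr0.
  by rewrite !mulr_ge0 // ?exprn_ge0.
apply: (@le_trans _ _ (`|w| * (m.+1%:R ^+ 2 + m.+1%:R) * `|h| ^+ 2 * (r * r ^+ m.+1))).
  rewrite mulrDr !mulrDl lerD2l.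
  have -> : r ^+ 2 * (m.+1%:R * `|h| ^+ 2 * `|w| ^+ m.+1) =
    `|w| * m.+1%:R * `|h| ^+ 2 * (r * (r * `|w| ^+ m)) by rewrite [`|w| ^+ m.+1]exprS; ring.
  apply: ler_wpM2l; first by rewrite !mulr_ge0 // ?exprn_ge0.
  by rewrite [r ^+ m.+1]exprS !ler_wpM2l // lerXn2r ?nnegrE.
rewrite !ler_wpM2r ?mulr_ge0 ?exprn_ge0 //.
rewrite ler_wpM2l // -(natr1 m.+1) sqrrD1 mulr2n -!addrA lerD2l lerDl.
by rewrite addr_ge0.
Qed.

Lemma sum_expr_le (K : numFieldType) (x : K) (n : nat) :
  0 <= x -> x < 1 -> \sum_(i < n) x ^+ i <= (1 - x)^-1.
Proof.
move=> x0 x1; have x1' : 0 < 1 - x by rewrite subr_gt0.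
rewrite -[leRHS]mul1r ler_pdivlMr // mulrC.
have -> : (1 - x) * \sum_(i < n) x ^+ i = 1 - x ^+ n.
  by rewrite -[RHS]opprB subrX1 -mulNr opprB.
by rewrite gerBl exprn_ge0.
Qed.

(** Each of the n terms of the geometric sum is at least x^n. *)
Lemma natr_expr_le (K : numFieldType) (x : K) (n : nat) :
  0 <= x -> x < 1 -> n%:R * x ^+ n <= (1 - x)^-1.
Proof.
move=> x0 x1; apply: le_trans (sum_expr_le _ x n x0 x1).
have -> : n%:R * x ^+ n = \sum_(i < n) x ^+ n by rewrite sumr_const card_ord mulr_natl.
apply: ler_sum => i _.
apply: ler_wiXn2l; [by []|exact: ltW|exact: ltnW].
Qed.

(** Shrinking the radius from r to r1 absorbs the factor m, as m (r1 / r)^m is bounded. *)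
Lemma bounded_natr_mul {K : numFieldType} {a : nat -> K} {r r1 M : K} :
  0 <= r1 -> r1 < r -> (forall m, `|a m| * r ^+ m <= M) ->
  forall m, `|m%:R * a m| * r1 ^+ m <= M / (1 - r1 / r).
Proof.
move=> r10 r1r aM m; have r0 : 0 < r := le_lt_trans r10 r1r.
have x0 : 0 <= r1 / r by rewrite divr_ge0 // ltW.
have x1 : r1 / r < 1 by rewrite ltr_pdivrMr // mul1r.
have -> : `|m%:R * a m| * r1 ^+ m = (`|a m| * r ^+ m) * (m%:R * (r1 / r) ^+ m).
  rewrite -{1}(divfK (lt0r_neq0 r0) r1) exprMn normrM normr_nat; ring.
apply: ler_pM => //; last exact: natr_expr_le.
  by rewrite mulr_ge0 // exprn_ge0 // ltW.
by rewrite mulr_ge0 // exprn_ge0.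
Qed.

(** Comparison with the geometric series of ratio r1 / r; the bound is uniform in n. *)
Lemma sum_bounded_le {K : numFieldType} {a : nat -> K} {r r1 M : K} (n : nat) :
  0 <= r1 -> r1 < r -> (forall m, `|a m| * r ^+ m <= M) ->
  \sum_(m < n) `|a m| * r1 ^+ m <= M / (1 - r1 / r).
Proof.
move=> r10 r1r aM; have r0 : 0 < r := le_lt_trans r10 r1r.
have M0 : 0 <= M.
  by apply: le_trans (aM 0%N); rewrite mulr_ge0 // exprn_ge0 // ltW.
have x0 : 0 <= r1 / r by rewrite divr_ge0 // ltW.
have x1 : r1 / r < 1 by rewrite ltr_pdivrMr // mul1r.
apply: le_trans (ler_wpM2l M0 (sum_expr_le _ _ n x0 x1)).
rewrite mulr_sumr; apply: ler_sum => m _.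
rewrite -{1}(divfK (lt0r_neq0 r0) r1) exprMn mulrCA mulrC.
by apply: ler_wpM2r => //; rewrite exprn_ge0.
Qed.

(** The number b is w P'(w), whence the factor w^-1. The quadratic remainders of the monomials are
    summed with a bound independent of the number of terms, which passes to the limit. *)
Lemma is_derive_power_series (K : numFieldType) (a : nat -> K) (P : K -> K)
    (r M w b : K) :
  (forall m, `|a m| * r ^+ m <= M) -> w != 0 -> `|w| < r ->
  (forall x, `|x| < r -> (series (fun m => a m * x ^+ m) @ \oo --> P x)%classic) ->
  (series (fun m => m%:R * a m * w ^+ m) @ \oo --> b)%classic ->
  is_derive w (1 : K) P (w^-1 * b).
Proof.
move=> aM w0 wr cP cb.
(* Radii |w| < r1 < r2 < r3 < r: the steps to r3 and r2 each absorb one factor m of the m^2 in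
   [exprD_quadratic], and the step to r1 makes the sum bounded. *)
have [w1 w1r] := midf_lt wr; set r1 := (`|w| + r) / 2 in w1 w1r.
have [r12 r2r] := midf_lt w1r; set r2 := (r1 + r) / 2 in r12 r2r.
have [r23 r3r] := midf_lt r2r; set r3 := (r2 + r) / 2 in r23 r3r.
have r10 : 0 < r1 := le_lt_trans (normr_ge0 _) w1.
have r20 := lt_trans r10 r12; have r30 := lt_trans r20 r23.
have a1 := bounded_natr_mul (ltW r30) r3r aM.
have a2 := bounded_natr_mul (ltW r20) r23 a1.
have a3 n := sum_bounded_le n (ltW r10) r12 a2.
set C := (X in forall n, _ <= X) in a3.
(* For |h| < r1 - |w| both w and w + h lie in the disc of radius r1; the division by r1^2 undoes the
   factor r^2 in [exprD_quadratic]. *)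
apply: (@is_derive_quadratic _ _ _ _ (C / r1 ^+ 2) (r1 - `|w|)).
  by rewrite subr_gt0.
move=> h hr.
have whr : `|w + h| <= r1.
  apply: (le_trans (ler_normD _ _)); rewrite addrC -lerBrDr; exact: ltW.
have cw := cP w wr.
have cwh := cP (w + h) (le_lt_trans whr w1r).
have L := cvgB (cvgB cwh cw) (cvgM (cvg_cst (h / w)) cb).
have -> : P (h + w) - P w - h * (w^-1 * b) = P (w + h) - P w - h / w * b.
  by rewrite (addrC h) mulrA.
apply: (cvg_norm_le _ _ _ _ (L _ _ _ _)) => n.
rewrite !fctE /series /= !big_mkord mulr_sumr -!sumrB.
have wn0 : 0 < `|w| by rewrite normr_gt0.
have r1n0 : r1 != 0 by rewrite gt_eqF.
(* Multiplying by |w| r1^2 brings the partial sums to the form bounded by [exprD_quadratic]. *)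
rewrite -(ler_pM2l wn0) -(@ler_pM2l _ (r1 ^+ 2)) ?exprn_gt0 //.
rewrite -normrM mulr_sumr.
have -> : r1 ^+ 2 * (`|w| * (C / r1 ^+ 2 * `|h| ^+ 2)) = `|w| * `|h| ^+ 2 * C.
  by field.
apply: le_trans (ler_wpM2l _ (a3 n)); last by rewrite mulr_ge0 // exprn_ge0.
rewrite mulr_sumr; apply: (@le_trans _ _ (r1 ^+ 2 * \sum_(i < n)
   `|a i| * `|w * ((w + h) ^+ i - w ^+ i) - h * (i%:R * w ^+ i)|)).
  apply: ler_wpM2l; first by rewrite exprn_ge0 // ltW.
  apply: (le_trans (ler_norm_sum _ _ _)); apply: ler_sum => i _.
  by rewrite -normrM le_eqVlt; apply/orP; left; apply/eqP; congr (`|_|); field.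
rewrite mulr_sumr; apply: ler_sum => i _.
rewrite mulrCA !normrM !normr_nat.
apply: (le_trans (ler_wpM2l _ (exprD_quadratic _ _ _ _ i (ltW w1) whr))) => //.
by rewrite le_eqVlt; apply/orP; left; apply/eqP; ring.
Qed.

(** * Convergence of complex series by comparison *)

Lemma normc_le_ReIm (R : realType) (z : Cplx R) :
  `|z| <= (`|complex.Re z| + `|complex.Im z|)%:C%C :> Cplx R.
Proof.
case: z => x y; rewrite normc_def /= lecR -[leRHS]ger0_norm ?addr_ge0 //.
rewrite -sqrtr_sqr ler_wsqrtr // sqrrD !real_normK ?num_real //.
rewrite -addrA [_ *+ 2 + _]addrC addrA lerDl mulrn_wge0 // mulr_ge0 //.
Qed.

Lemma Re_le_normc (R : realType) (z : Cplx R) :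
  `|complex.Re z| <= complex.Re `|z|.
Proof. by rewrite -lecR (le_trans (normc_ge_Re z)) // normc_def. Qed.

Lemma Im_le_normc (R : realType) (z : Cplx R) :
  `|complex.Im z| <= complex.Re `|z|.
Proof.
case: z => x y; rewrite normc_def /= -sqrtr_sqr ler_wsqrtr //.
by rewrite lerDr sqr_ge0.
Qed.

Lemma cvg_Complex (R : realType) (u v : nat -> R) (a b : R) :
  (u @ \oo --> a)%classic -> (v @ \oo --> b)%classic ->
  ((fun n => Complex (u n) (v n) : Cplx R) @ \oo --> (Complex a b : Cplx R))%classic.
Proof.
move=> ua vb; apply/cvgrPdist_le => e e0.
have eE : e = (complex.Re e)%:C%C by rewrite RRe_real // gtr0_real.
have re0 : 0 < complex.Re e / 2 by rewrite divr_gt0 // -ltcR -eE.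
near=> n; apply: le_trans (normc_le_ReIm _ _) _.
rewrite eE lecR /= (splitr (complex.Re e)); apply: lerD.
  by near: n; move/cvgrPdist_le: ua; apply.
by near: n; move/cvgrPdist_le: vb; apply.
Unshelve. all: by end_near.
Qed.

(** Real and imaginary parts are dominated by the norm, so both real series converge absolutely. *)
Lemma cvg_series_le_norm (R : realType) (u : nat -> Cplx R) (v : nat -> R) :
  (forall n, `|u n| <= (v n)%:C%C :> Cplx R) -> cvgn (series v) -> cvgn (series u).
Proof.
move=> uv cv.
have uv' n : complex.Re `|u n| <= v n by have := uv n; rewrite normc_def lecR.
have cp (p : Cplx R -> R) : (forall z, `|p z| <= complex.Re `|z|) ->
    cvgn (series (p \o u)).
  move=> pz; apply: normed_cvg; apply: series_le_cvg cv => n //=.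
    by apply: le_trans (uv' n); apply: le_trans (pz _).
  exact: le_trans (uv' n).
have /cvg_ex[a ca] := cp _ (@Re_le_normc R).
have /cvg_ex[b cb] := cp _ (@Im_le_normc R).
apply/cvg_ex; exists (Complex a b).
rewrite (_ : series u = fun n => Complex (series (@complex.Re R \o u) n)
  (series (@complex.Im R \o u) n)); first exact: cvg_Complex.
apply/funext => n; rewrite /series /=.
elim: n => [|n IH]; first by rewrite !big_geq.
by rewrite !big_nat_recr //= IH; case: (u n).
Qed.

Lemma cvg_power_series (R : realType) (a : nat -> Cplx R) (r M w : Cplx R) :
  (forall m, `|a m| * r ^+ m <= M) -> `|w| < r ->
  cvgn (series (fun m => a m * w ^+ m)).
Proof.
move=> aM wr; have r0 : 0 < r := le_lt_trans (normr_ge0 _) wr.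
have M0 : 0 <= M.
  by apply: le_trans (aM 0%N); rewrite mulr_ge0 // exprn_ge0 // ltW.
set x := `|w| / r.
have x0 : 0 <= x by rewrite divr_ge0 // ltW.
have x1 : x < 1 by rewrite ltr_pdivrMr // mul1r.
(* Being nonnegative in the order of the complex numbers, x and M are real; the majorant is the real
   geometric series with these values. *)
have xE : x = (complex.Re x)%:C%C by rewrite RRe_real // ger0_real.
have ME : M = (complex.Re M)%:C%C by rewrite RRe_real // ger0_real.
apply: (@cvg_series_le_norm _ _ (geometric (complex.Re M) (complex.Re x))).
  move=> n; rewrite /geometric /= rmorphM rmorphXn /= -xE -ME /x.
  rewrite normrM normrX -{1}(divfK (lt0r_neq0 r0) `|w|) exprMn mulrCA mulrC.
  by apply: ler_wpM2r => //; rewrite exprn_ge0.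
apply: is_cvg_geometric_series; rewrite ger0_norm.
  by rewrite -ltcR -xE.
by rewrite -lecR -xE.
Qed.

(** * The complex exponential and its derivative *)

Lemma cexpD (R : realType) (z w : Cplx R) : cexp (z + w) = cexp z * cexp w.
Proof.
case: z => x y; case: w => u v; rewrite /cexp /= expRD cosD sinD.
by apply/eqP; rewrite eq_complex /=; apply/andP; split; apply/eqP; ring.
Qed.

Lemma cexp0 (R : realType) : cexp (0 : Cplx R) = 1.
Proof. by rewrite /cexp /= expR0 cos0 sin0 mul1r mulr0. Qed.

Lemma cexpMn (R : realType) (z : Cplx R) (m : nat) :
  cexp (m%:R * z) = cexp z ^+ m.
Proof.
elim: m => [|m IH]; first by rewrite mul0r cexp0.
by rewrite -natr1 mulrDl mul1r cexpD IH exprSr.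
Qed.

Lemma norm_cexp (R : realType) (z : Cplx R) : `|cexp z| = (expR (complex.Re z))%:C%C :> Cplx R.
Proof.
rewrite normc_def /= !exprMn -mulrDr cos2Dsin2 mulr1 sqrtr_sqr ger0_norm ?expR_ge0 //.
Qed.

(** From 1 + x <= exp x and 1 - x <= exp (- x), the remainder lies between 0 and x^2 / (1 - x). *)
Lemma expR_quadratic (R : realType) (x : R) :
  `|x| <= 2^-1 -> `|expR x - 1 - x| <= 2 * x ^+ 2.
Proof.
rewrite ler_norml => /andP[x1 x2].
have := expR_ge1Dx x; have := expR_ge1Dx (- x); rewrite expRN.
have := expR_gt0 x; move: (expR x) => E E0 H1 H2.
rewrite ger0_norm; last lra.
have : (1 - x) * E <= 1 by rewrite -ler_pdivlMr // div1r.
nra.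
Qed.

Lemma sin_le_norm (R : realType) (x : R) : `|sin x| <= `|x|.
Proof.
wlog x0 : x / 0 <= x.
  move=> H; have [/H//|/ltW x0] := leP 0 x.
  by rewrite -normrN -sinN -(normrN x); apply: H; rewrite oppr_ge0.
have [c _] := @MVT_segment _ sin cos 0 x x0 (fun x _ => is_derive_sin x)
  (continuous_subspaceT (@continuous_sin R)).
rewrite sin0 !subr0 => ->; rewrite normrM ler_piMl //; exact: cos_max.
Qed.

Lemma cos_quadratic (R : realType) (x : R) : `|cos x - 1| <= x ^+ 2.
Proof.
have -> : cos x - 1 = - (2 * sin (x / 2) ^+ 2).
  rewrite {1}(splitr x) cosD -!expr2 cos2sin2; ring.
rewrite normrN ger0_norm; last by rewrite mulr_ge0 // sqr_ge0.
have := sin_le_norm _ (x / 2).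
rewrite -ler_sqr ?nnegrE // !real_normK ?num_real // exprMn => H.
have := sqr_ge0 x; lra.
Qed.

(** By the mean value theorem for sin t - t and [cos_quadratic], the left side is at most |x|^3. *)
Lemma sin_quadratic (R : realType) (x : R) : `|x| <= 1 -> `|sin x - x| <= x ^+ 2.
Proof.
wlog x0 : x / 0 <= x.
  move=> H; have [/H//|/ltW x0 x1] := leP 0 x.
  rewrite -normrN opprD -sinN -(sqrrN x); apply: H; first by rewrite oppr_ge0.
  by rewrite normrN.
have dE (y : R) : is_derive y 1 (fun t => sin t - t) (cos y - 1) by exact: is_deriveB.
have dc : continuous (fun t : R => sin t - t).
  move=> y; apply: differentiable_continuous; apply/derivable1_diffP.
  by have [] := dE y.
have [c] := @MVT_segment _ (fun t => sin t - t) (fun y => cos y - 1) 0 x x0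
  (fun x _ => dE x) (continuous_subspaceT dc).
rewrite in_itv /= sin0 !subr0 => /andP[c0 cx] ->; rewrite normrM.
rewrite (ger0_norm x0) => x1.
have H := cos_quadratic _ c.
have : c ^+ 2 <= x ^+ 2 by rewrite ler_sqr ?nnegrE.
have := normr_ge0 (cos c - 1).
move: `|cos c - 1| H => k H k0 cx2; nra.
Qed.

Lemma cexp_quadratic (R : realType) (h : Cplx R) : `|h| <= 2^-1 ->
  `|cexp h - 1 - h| <= 10 * `|h| ^+ 2.
Proof.
move=> h1.
have nE : `|h| = (complex.Re `|h|)%:C%C by rewrite RRe_real.
have hx := Re_le_normc _ h; have hy := Im_le_normc _ h.
have h1' : complex.Re `|h| <= 2^-1.
  by rewrite -lecR -nE fmorphV rmorphMn.
rewrite [in leRHS]nE; move: (complex.Re `|h|) h1' hx hy => N N1.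
clear h1 nE; case: h => x y /= hx hy.
apply: (le_trans (normc_le_ReIm _ _)).
have -> : 10 * (N%:C)%C ^+ 2 = (10 * N ^+ 2)%:C%C :> Cplx R.
  by rewrite rmorphM rmorphXn /= rmorph_nat.
rewrite lecR /=.
have ex := expR_quadratic _ x (le_trans hx N1).
have cy := cos_quadratic _ y.
have sy : `|sin y - y| <= y ^+ 2 by apply: sin_quadratic; lra.
have N0 : 0 <= N := le_trans (normr_ge0 _) hx.
have x2 : x ^+ 2 <= N ^+ 2 by rewrite -(real_normK (num_real x)) ler_sqr ?nnegrE.
have y2 : y ^+ 2 <= N ^+ 2 by rewrite -(real_normK (num_real y)) ler_sqr ?nnegrE.
have E2 : `|expR x - 1| <= 2 * N.
  rewrite -[_ - 1](subrK x); apply: (le_trans (ler_normD _ _)).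
  nra.
have E3 : `|expR x| <= 2.
  rewrite -[expR x](subrK 1); apply: (le_trans (ler_normD _ _)).
  rewrite normr1; lra.
(* Each part of the remainder splits into two terms of size at most 2 N^2, so 8 N^2 in total, within
   the constant 10. *)
have -> : expR x * cos y - 1 - x = expR x * (cos y - 1) + (expR x - 1 - x) by ring.
have -> : expR x * sin y - 0 - y = expR x * (sin y - y) + (expR x - 1) * y by ring.
have := ler_normD (expR x * (cos y - 1)) (expR x - 1 - x).
have := ler_normD (expR x * (sin y - y)) ((expR x - 1) * y).
rewrite !normrM.
have M1 : `|expR x| * `|cos y - 1| <= 2 * N ^+ 2.
  by apply: ler_pM => //; exact: le_trans y2.
have M2 : `|expR x| * `|sin y - y| <= 2 * N ^+ 2.
  by apply: ler_pM => //; exact: le_trans y2.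
have M3 : `|expR x - 1| * `|y| <= 2 * N ^+ 2.
  by rewrite expr2 mulrA; apply: ler_pM.
have := sqr_ge0 N; lra.
Qed.

Lemma is_derive_cexp (R : realType) (z : Cplx R) :
  is_derive z (1 : Cplx R) (@cexp R) (cexp z).
Proof.
apply: (@is_derive_quadratic _ _ _ _ (`|cexp z| * 10) 2^-1).
  by rewrite invr_gt0.
move=> h /ltW h1; rewrite cexpD.
have -> : cexp h * cexp z - cexp z - h * cexp z = cexp z * (cexp h - 1 - h) by ring.
by rewrite normrM -mulrA ler_wpM2l // cexp_quadratic.
Qed.

(** * Fourier expansions under [D] *)

Lemma two_pi_i_neq0 (R : realType) : two_pi_i R != 0.
Proof. by rewrite eq_complex /= eqxx /= mulf_neq0 // gt_eqF // pi_gt0. Qed.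

Lemma D_is_derive (R : realType) (f : Cplx R -> Cplx R) (z b : Cplx R) :
  is_derive z (1 : Cplx R) f (two_pi_i R * b) -> D f z = b.
Proof. by move=> [_ fE]; rewrite /D derive1E fE mulKf ?two_pi_i_neq0. Qed.

Definition qexp {R : realType} (q : nat -> Cplx R) (z : Cplx R) : nat -> Cplx R :=
  series (fun m => q m * cexp (two_pi_i R * m%:R * z)).

Lemma qexpE (R : realType) (q : nat -> Cplx R) (z : Cplx R) :
  qexp q z = series (fun m => q m * cexp (two_pi_i R * z) ^+ m).
Proof.
congr series; apply/funext => m; rewrite -cexpMn; congr (_ * cexp _).
by rewrite mulrAC mulrC.
Qed.

Lemma norm_cexp_two_pi_i (R : realType) (z : Cplx R) :
  `|cexp (two_pi_i R * z)| = (expR (- (2 * pi * complex.Im z)))%:C%C :> Cplx R.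
Proof. by rewrite norm_cexp; case: z => x y /=; rewrite mul0r sub0r. Qed.

(** On this neighbourhood exp(2 pi i x) stays inside the disc whose radius is its norm at height Im
    z / 2. *)
Lemma near_half_Im (R : realType) (z : Cplx R) : upper_half_plane R z ->
  (\forall x \near z, complex.Im z / 2 < complex.Im x)%classic.
Proof.
rewrite /upper_half_plane /= => z0.
have e0 : 0 < (complex.Im z / 2)%:C%C :> Cplx R by rewrite ltcR divr_gt0.
apply/nbhs_normP; exists (complex.Im z / 2)%:C%C => // x.
rewrite /ball_ /= normc_def ltcR => H.
have := le_lt_trans (Im_le_normc _ (z - x)); rewrite normc_def => /(_ _ H).
rewrite raddfB /= ltr_norml => /andP[_]; lra.
Qed.

(** The limit b is the value of [D f] at z; giving its expansion together with the derivative is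
    what allows iteration. *)
Lemma is_derive_qexp {R : realType} {f : Cplx R -> Cplx R} {q : nat -> Cplx R} :
  (forall z, upper_half_plane R z -> (qexp q z @ \oo --> f z)%classic) ->
  forall z, upper_half_plane R z ->
    exists2 b : Cplx R, (qexp (fun m => m%:R * q m) z @ \oo --> b)%classic &
      is_derive z (1 : Cplx R) f (two_pi_i R * b).
Proof.
move=> fq z z0.
pose e (x : Cplx R) := cexp (two_pi_i R * x).
pose z' : Cplx R := Complex (complex.Re z) (complex.Im z / 2).
have z'0 : upper_half_plane R z' by rewrite /upper_half_plane /= divr_gt0.
(* The terms of a convergent series tend to 0, hence are bounded. *)
have [M qM] : exists M, forall m, `|q m| * `|e z'| ^+ m <= M.
  have cq : cvgn (series (fun m => q m * e z' ^+ m)).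
    by apply/cvg_ex; exists (f z'); rewrite -qexpE; exact: fq.
  have [M [Mr H]] := cvg_seq_bounded (cvgP _ (cvg_series_cvg_0 cq)).
  exists (M + 1) => m; rewrite -normrX -normrM.
  by apply: H; rewrite // ltrDl.
have lt_e x : complex.Im z / 2 < complex.Im x -> `|e x| < `|e z'|.
  by move=> zx; rewrite !norm_cexp_two_pi_i ltcR ltr_expR ltrN2 ltr_pM2l ?mulr_gt0 ?pi_gt0.
have ez : `|e z| < `|e z'|.
  by apply: lt_e; rewrite ltr_pdivrMr // ltr_pMr // ltr1n.
have ez0 : e z != 0 by rewrite -normr_gt0 norm_cexp_two_pi_i ltcR expR_gt0.
(* An intermediate radius leaves room to absorb the factor m and still have convergence at [e z]. *)
have [r1 r2] := midf_lt ez.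
have qM1 := bounded_natr_mul (ltW (le_lt_trans (normr_ge0 _) r1)) r2 qM.
have /cvg_ex[b cb] := cvg_power_series _ _ _ _ _ qM1 r1.
exists b; first by rewrite qexpE.
pose P x := limn (series (fun m => q m * x ^+ m)).
have cP x : `|x| < `|e z'| -> (series (fun m => q m * x ^+ m) @ \oo --> P x)%classic.
  exact: cvg_power_series qM.
have dP := is_derive_power_series _ _ _ _ _ _ _ qM ez0 ez cP cb.
have de : is_derive z (1 : Cplx R) e (e z * two_pi_i R).
  apply: is_derive_comp; first exact: is_derive_cexp.
  (* The inner map is linear, so its remainder is exactly 0. *)
  apply: (@is_derive_quadratic _ _ _ _ 0 1) => // h _.
  by rewrite mulrDr addrK mulrC subrr normr0 mul0r.
have -> : two_pi_i R * b = (e z)^-1 * b * (e z * two_pi_i R).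
  by move: (e z) (two_pi_i R) ez0 => u v u0; rewrite mulrACA mulVf // mul1r mulrC.
(* Near z, f equals P composed with [e], by uniqueness of limits. *)
apply: near_eq_is_derive (is_derive_comp _ _ _ _ _ _ dP de).
apply: filterS (near_half_Im _ _ z0) => x zx /=.
have x0 : upper_half_plane R x.
  by rewrite /upper_half_plane /=; apply: lt_trans zx; rewrite divr_gt0.
have := fq x x0; rewrite qexpE.
exact: (cvg_unique _ (cP _ (lt_e _ zx))).
Qed.

Lemma D_qexp (R : realType) (f : Cplx R -> Cplx R) (q : nat -> Cplx R) :
  (forall z, upper_half_plane R z -> (qexp q z @ \oo --> f z)%classic) ->
  forall z, upper_half_plane R z ->
    (qexp (fun m => m%:R * q m) z @ \oo --> D f z)%classic.
Proof.
move=> fq z z0; have [b cb db] := is_derive_qexp fq _ z0.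
by rewrite (D_is_derive _ _ _ _ db).
Qed.

Lemma iter_D_qexp {R : realType} {f : Cplx R -> Cplx R} {q : nat -> Cplx R} (r : nat) :
  (forall z, upper_half_plane R z -> (qexp q z @ \oo --> f z)%classic) ->
  exists p, forall z, upper_half_plane R z ->
    (qexp p z @ \oo --> iter r (@D R) f z)%classic.
Proof.
move=> fq; elim: r => [|r [p IH]]; first by exists q.
by exists (fun m => m%:R * p m); exact: D_qexp.
Qed.

Lemma is_derive_iter_D {R : realType} {k s : nat} {f : Cplx R -> Cplx R} (r : nat) :
  quasimodular k s f -> forall z, upper_half_plane R z ->
  is_derive z (1 : Cplx R) (iter r (@D R) f) (two_pi_i R * iter r.+1 (@D R) f z).
Proof.
move=> [_ _ [q fq]] z z0; have [p /is_derive_qexp/(_ _ z0)[b _ db]] := iter_D_qexp r fq.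
by rewrite iterS (D_is_derive _ _ _ _ db).
Qed.

(** * The product rule for [Phi] *)

Theorem theorem2 (R : realType) (k l s t n : nat)
    (hk : (0 < k)%N) (hl : (0 < l)%N)
    (hs : (s <= k %/ 2)%N) (ht : (t <= l %/ 2)%N)
    (f g : Cplx R -> Cplx R)
    (hf : quasimodular k s f) (hg : quasimodular l t g)
    (z : Cplx R) (hz : upper_half_plane R z) :
  D (Phi n k%:Z s%:Z l%:Z t%:Z f g) z =
    Phi n k%:Z s%:Z (l%:Z + 2) (t%:Z + 1) f (D g) z
    + Phi n (k%:Z + 2) (s%:Z + 1) l%:Z t%:Z (D f) g z.
Proof.
set A := k%:Z - s%:Z + n%:Z - 1; set B := l%:Z - t%:Z + n%:Z - 1.
(* Raising the weight by 2 and the depth by 1 raises the upper argument of the binomial by 1, as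
   Pascal's rule requires. *)
have AE : k%:Z + 2 - (s%:Z + 1) + n%:Z - 1 = A + 1 by rewrite /A; ring.
have BE : l%:Z + 2 - (t%:Z + 1) + n%:Z - 1 = B + 1 by rewrite /B; ring.
pose c (r : 'I_n.+1) : Cplx R := (-1) ^+ r * binomz R A (n - r) * binomz R B r.
pose F r := iter r (@D R) f; pose G r := iter r (@D R) g.
(* Written as a linear combination of products of functions, [Phi] can be differentiated by the sum,
   scaling and product rules. *)
have PhiE : Phi n k%:Z s%:Z l%:Z t%:Z f g =
    \sum_(r < n.+1) c r \*: (F r * G (n - r)%N).
  by apply/funext => x; rewrite fct_sumE; apply: eq_bigr => r _; exact: (esym (mulrA _ _ _)).
have dF r : is_derive z (1 : Cplx R) (F r) (two_pi_i R * F r.+1 z).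
  exact: is_derive_iter_D hf _ hz.
have dG r : is_derive z (1 : Cplx R) (G r) (two_pi_i R * G r.+1 z).
  exact: is_derive_iter_D hg _ hz.
apply: D_is_derive; rewrite PhiE; apply: (is_derive_eq (is_derive_sum
  (fun r : 'I_n.+1 => is_deriveZ (c r) (is_deriveM (dF r) (dG (n - r)%N))))).
rewrite /Phi AE BE.
(* Iterates of [D] on [D g] and [D f] become entries of [G] and [F] with index one higher. *)
under [X in _ = _ * (X + _)]eq_bigr do rewrite -iterSr.
under [X in _ = _ * (_ + X)]eq_bigr do rewrite -iterSr.
rewrite -(leibniz_binomz _ _ _ _ (fun r => F r z) (fun r => G r z)) mulr_sumr.
apply: eq_bigr => r _.
rewrite -/(c r).
move: (c r) (F r z) (F r.+1 z) (G (n - r)%N z) (G (n - r).+1 z) (two_pi_i R).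
move=> c0 F0 F1 G0 G1 u; rewrite /GRing.scale /=. ring.
Qed.
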